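(* There exists an infinite family of metric spaces $\{(V_\ell,d_{V_\ell})\}$ and terminal sequences $\{\sigma_\ell\}$ (with $\sigma_\ell$ a sequence of points of $V_\ell$) such that every probabilistic online embedding of $\sigma_\ell$ into HSTs has expected distortion at least $$\Omega\left(\frac{\log k\cdot\log\Phi_\ell}{\log\log k}\right),$$ where $k=|\sigma_\ell|$ and $\Phi_\ell$ is the aspect ratio of $(V_\ell,d_{V_\ell})$; moreover $\Phi_\ell$ can be as large as $2^{k^{1-\delta}}$ for any fixed $\delta\in(0,1)$.
   Context: An online embedding of a sequence of points $x_1,\ldots,x_k$ of a metric space $(V,d_V)$ into a metric space $(M,d_M)$ is a sequence of maps $f_1,\ldots,f_k$ such that for each $i$: (1) $f_i$ is a non-contractive embedding of $\{x_1,\ldots,x_i\}$ into $M$; (2) $f_i$ extends $f_{i-1}$. Its distortion is the distortion of $f_k$. A probabilistic online embedding is a probability distribution over online embeddings; its expected distortion is $\max_{u\neq v}E[d_M(f_k(u),f_k(v))]/d_V(u,v)$. An HST ($\mu$-HST for some $\mu>1$) metric is the metric on the leaves of a rooted tree in which each node $v$ has a label $\Delta(v)\ge0$, with $\Delta(v)=0$ iff $v$ is a leaf, and $\Delta(v)\le\Delta(u)/\mu$ whenever $v$ is a child of $u$; the distance between two leaves is the label of their least common ancestor. The aspect ratio of a finite metric space is the ratio of its maximum to its minimum nonzero pairwise distance.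
   Formalization: For a sequence fixed in advance the claim fails (an offline embedding into HSTs has expected distortion O(log k)); proved instead: for every probabilistic online embedding algorithm on V_ℓ, not knowing the sequence ahead, some terminal sequence σ of k points has at least this expected distortion. *)

(* Defs.v *)
From HB Require Import structures.
From mathcomp Require Import all_boot all_order all_algebra.
From mathcomp Require Import all_classical all_reals all_analysis.
Set Implicit Arguments. Unset Strict Implicit. Unset Printing Implicit Defensive.
Import Order.TTheory GRing.Theory Num.Theory.
Local Open Scope ring_scope.

Section Defs.
Variable R : realType.

Definition is_metric (V : finType) (d : V -> V -> R) : Prop :=
  (forall x y, 0 <= d x y) /\
  (forall x y, d x y = 0 <-> x = y) /\
  (forall x y, d x y = d y x) /\
  (forall x y z, d x z <= d x y + d y z).

Definition max_dist (V : finType) (d : V -> V -> R) : R :=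
  \big[Num.max/0]_(x : V) \big[Num.max/0]_(y : V) d x y.

Definition min_dist (V : finType) (d : V -> V -> R) : R :=
  \big[Num.min/max_dist d]_(x : V) \big[Num.min/max_dist d]_(y : V | y != x) d x y.

Definition aspect_ratio (V : finType) (d : V -> V -> R) : R :=
  max_dist d / min_dist d.

Record rtree := RTree {
  node : finType;
  root : node;
  par : node -> node;
  lab : node -> R }.

Definition anc (T : rtree) (w v : node T) : bool :=
  [exists n : 'I_#|node T|, iter n (@par T) v == w].

Definition is_child (T : rtree) (u v : node T) : bool :=
  (u != root T) && (par u == v).

Definition is_leaf (T : rtree) (v : node T) : bool :=
  [forall u : node T, ~~ is_child u v].

Definition well_rooted (T : rtree) : Prop :=
  par (root T) = root T /\ forall v : node T, anc (root T) v.

Definition is_muHST (mu : R) (T : rtree) : Prop :=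
  well_rooted T /\
  (forall v : node T, 0 <= lab v) /\
  (forall v : node T, lab v = 0 <-> is_leaf v) /\
  (forall u v : node T, is_child u v -> lab u <= lab v / mu).

Definition is_HST (T : rtree) : Prop := exists mu : R, 1 < mu /\ is_muHST mu T.

Definition lca (T : rtree) (u v : node T) : node T :=
  odflt (root T)
    [pick w : node T | [&& anc w u, anc w v &
        [forall w' : node T, (anc w' u && anc w' v) ==> anc w' w]]].

Definition hst_dist (T : rtree) (u v : node T) : R := lab (lca u v).

Record online_alg (V : finType) (k : nat) := OnlineAlg {
  tree_of : k.-tuple V -> rtree;
  emb : forall s : k.-tuple V, 'I_k -> node (tree_of s) }.

Definition pair_dist (V : finType) (k : nat) (A : online_alg V k)
  (s : k.-tuple V) (a b : 'I_k) : R :=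
  hst_dist (emb A s a) (emb A s b).

(* Validity: on every sequence of k distinct terminals the output is a
   non-contractive embedding into (the leaves of) an HST, and it is online:
   the embedding of the first i terminals depends only on those i terminals
   (the embedded prefix is kept, i.e. its distances never change). *)
Definition valid_online_alg (V : finType) (d : V -> V -> R) (k : nat)
  (A : online_alg V k) : Prop :=
  (forall s : k.-tuple V, uniq s ->
     is_HST (tree_of A s) /\
     (forall a : 'I_k, is_leaf (emb A s a)) /\
     (forall a b : 'I_k, d (tnth s a) (tnth s b) <= pair_dist A s a b)) /\
  (forall (s s' : k.-tuple V) (i : nat), uniq s -> uniq s' ->
     take i s = take i s' ->
     forall a b : 'I_k, (a < i)%N -> (b < i)%N ->
       pair_dist A s a b = pair_dist A s' a b).

Definition expected_distortion (V : finType) (d : V -> V -> R) (k : nat)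
  (dsp : measure_display) (Omega : measurableType dsp)
  (P : probability Omega R) (A : Omega -> online_alg V k)
  (s : k.-tuple V) : \bar R :=
  \big[maxe/0%E]_(a < k) \big[maxe/0%E]_(b < k | (a < b)%N)
     ((\int[P]_w (pair_dist (A w) s a b)%:E) * ((d (tnth s a) (tnth s b))^-1)%:E)%E.

End Defs.

(* Main.v *)
Require Import Defs.
From HB Require Import structures.
From mathcomp Require Import all_boot all_order all_algebra all_fingroup.
From mathcomp Require Import all_classical all_reals all_analysis.
From mathcomp Require Import measurable_realfun zify ring lra.
Import Order.TTheory GRing.Theory Num.Theory.
Local Open Scope ring_scope.

(** The terminals live in the cube [{0,1}^N] with the Hamming metric, where
    [N = m^L] and [m = 16 r]. Given two revealed points at distance [m * rho],
    the adversary reveals a copy of the [m]-cube scaled by [rho] that has these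
    two points as antipodes, and continues with the endpoints of a suitably
    chosen cube edge, for [L] rounds.

    Let [D] be the ultrametric that a non-contractive embedding puts on such a
    copy. On every monotone path between the antipodes some edge has [D]-length
    at least [D(0,1)], so a random edge of a random path keeps, on average, the
    distortion of the pair. On top of this, call an edge light if its [D]-length
    is below [rho * r]. Light components have Hamming diameter below [r], hence
    the graph of light edges is [r]-degenerate, whereas the middle layers have
    degrees at least [4 r] both upwards and downwards. So most edges there are
    heavy, and the distortion grows by [Omega(r)] in each round. After [L]
    rounds it is [Omega(L r)], while [log k] is of order [r] and the logarithm
    of the aspect ratio is [L log m]. *)

(** * HST distances are ultrametrics *)

Lemma anc_fconnect (R : realType) (T : rtree R) (w v : node T) :
  anc w v = fconnect (@par R T) v w.
Proof.
apply/existsP/idP => [[n /eqP <-]|h]; first exact: fconnect_iter.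
have lt : (findex (@par R T) v w < #|node T|)%N.
  by apply: leq_trans (findex_max h) _; exact: max_card.
by exists (Ordinal lt); rewrite /= iter_findex.
Qed.

(** The default value in [lca] is never taken: the first ancestor of [u], on the way to the root,
    that lies above [v] is below all other common ancestors. *)
Lemma lcaP (R : realType) (T : rtree R) (u v : node T) : well_rooted T ->
  [/\ anc (lca u v) u, anc (lca u v) v &
      forall w, anc w u -> anc w v -> anc w (lca u v)].
Proof.
move=> [_ wr]; rewrite /lca; case: pickP => [w /and3P[-> -> /forallP h]|none].
  by split=> // w' h1 h2; move: (h w'); rewrite h1 h2.
have ex : exists n, anc (iter n (@par R T) u) v.
  have := wr u; rewrite anc_fconnect => h; exists (findex (@par R T) u (Defs.root T)).
  by rewrite iter_findex.
case: (ex_minnP ex) => n hn nmin.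
have := none (iter n (@par R T) u); rewrite {1}anc_fconnect fconnect_iter hn /=.
move/negbT/negP; case; apply/forallP => w; apply/implyP => /andP[hu hv].
move: (hu); rewrite !anc_fconnect => hu'.
rewrite -(iter_findex hu') in hv *.
by rewrite -(subnK (nmin _ hv)) iterD; exact: fconnect_iter.
Qed.

Lemma hst_dist_sym (R : realType) (T : rtree R) (u v : node T) :
  hst_dist u v = hst_dist v u.
Proof.
rewrite /hst_dist /lca; congr (lab (odflt _ _)); apply: eq_pick => w /=.
rewrite andbCA; congr [&& _, _ & _]; apply: eq_forallb => w'.
by rewrite (andbC (anc w' u)).
Qed.

Lemma lab_anc (R : realType) (T : rtree R) (w v : node T) :
  is_HST T -> anc w v -> lab v <= lab w.
Proof.
move=> [mu [mu1 [[rr _] [lab0 [_ labc]]]]].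
have lab_par (u : node T) : lab u <= lab (par u).
  have [->|ur] := eqVneq u (Defs.root T); first by rewrite rr.
  have /labc/le_trans : is_child u (par u) by rewrite /is_child ur eqxx.
  apply; rewrite ler_pdivrMr ?(lt_trans ltr01) //.
  by rewrite ler_peMr // ltW.
case/existsP => n /eqP <-; elim: (n : nat) => //= p /le_trans; exact.
Qed.

Lemma anc_chain (R : realType) (T : rtree R) (w w' v : node T) :
  anc w v -> anc w' v -> anc w w' || anc w' w.
Proof.
case/existsP => n /eqP <- /existsP[p /eqP <-]; rewrite !anc_fconnect.
case: (leqP n p) => [le|/ltnW le]; rewrite -{1 2}(subnK le) iterD fconnect_iter ?orbT //.
Qed.

(** The ancestors of [y] form a chain, so one of [lca x y], [lca y z] lies above the other and hence
    above [x] and [z]; labels do not decrease upwards. *)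
Lemma hst_dist_ultra (R : realType) (T : rtree R) (x y z : node T) :
  is_HST T -> hst_dist x z <= Num.max (hst_dist x y) (hst_dist y z).
Proof.
move=> hT; have wr : well_rooted T by case: hT => mu [_ []].
have anc_trans (a b c : node T) : anc a b -> anc b c -> anc a c.
  rewrite !anc_fconnect => ab bc; exact: connect_trans bc ab.
have [a1 a2 _] := lcaP _ _ x y wr; have [b1 b2 _] := lcaP _ _ y z wr.
have [_ _ c3] := lcaP _ _ x z wr.
rewrite le_max /hst_dist; case/orP: (anc_chain _ _ _ _ _ a2 b1) => h; apply/orP; [left|right].
  by apply: lab_anc hT (c3 _ a1 (anc_trans _ _ _ h b2)).
by apply: lab_anc hT (c3 _ (anc_trans _ _ _ h a1) b2).
Qed.

(** * Monotone paths in the cube and their random steps *)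

Definition hamming (n : nat) (x y : {ffun 'I_n -> bool}) : nat :=
  #|[set i | x i != y i]|.

Definition flip (n : nat) (x : {ffun 'I_n -> bool}) (j : 'I_n) : {ffun 'I_n -> bool} :=
  [ffun i => x i (+) (i == j)].

(** The path flips the coordinates [s 0, s 1, ...] in turn; coordinate [j] is set once step [s^-1 j]
    is done. *)
Definition path_vertex (m : nat) (s : 'S_m) (i : nat) : {ffun 'I_m -> bool} :=
  [ffun j => ((s^-1)%g j < i)%N].

Lemma flipK (n : nat) (x : {ffun 'I_n -> bool}) (j : 'I_n) : flip n (flip n x j) j = x.
Proof. by apply/ffunP => i; rewrite !ffunE -addbA addbb addbF. Qed.

Lemma hamming_flip (n : nat) (x y : {ffun 'I_n -> bool}) (j : 'I_n) :
  x j = y j -> hamming n x (flip n y j) = (hamming n x y).+1.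
Proof.
move=> xy; rewrite /hamming.
have -> : [set i | x i != flip n y j i]%SET = (j |: [set i | x i != y i])%SET.
  apply/setP => i; rewrite !inE ffunE; case: (eqVneq i j) => [->|_].
    by rewrite xy addbT; case: (y j).
  by rewrite addbF.
by rewrite cardsU1 inE xy eqxx.
Qed.

Lemma path_vertex0 (m : nat) (s : 'S_m) : path_vertex m s 0 = [ffun=> false].
Proof. by apply/ffunP => j; rewrite !ffunE. Qed.

Lemma path_vertexT (m : nat) (s : 'S_m) : path_vertex m s m = [ffun=> true].
Proof. by apply/ffunP => j; rewrite !ffunE ltn_ord. Qed.

Lemma path_vertexS (m : nat) (s : 'S_m) (i : 'I_m) :
  path_vertex m s i.+1 = flip m (path_vertex m s i) (s i).
Proof.
apply/ffunP => j; rewrite !ffunE ltnS leq_eqVlt -(inj_eq (@perm_inj _ s^-1)) permK.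
by rewrite (inj_eq val_inj); case: eqVneq => [->|]; rewrite ?ltnn ?addbF.
Qed.

(** The [i]-th vertex depends only on the set of the first [i] directions, which swapping two steps
    on the same side of [i] preserves. *)
Lemma path_vertex_tperm (m : nat) (s : 'S_m) (i : nat) (a b : 'I_m) :
  (a < i)%N = (b < i)%N -> path_vertex m (tperm a b * s)%g i = path_vertex m s i.
Proof.
move=> ab; apply/ffunP => j; rewrite !ffunE invMg permM tpermV.
by case: tpermP => [->|->|].
Qed.

(* Averaging over the transpositions of [i0] with the positions in [Q], all of
   which fix the [i]-th vertex of the path. *)
Lemma path_step_count (m r i : nat) (i0 : 'I_m) (Q : {set 'I_m})
    (J : {ffun 'I_m -> bool} -> {set 'I_m}) :
  (forall x, #|J x| <= r)%N ->
  (forall b, b \in Q -> (i0 < i)%N = (b < i)%N) ->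
  (#|Q| * #|[set s : 'S_m | s i0 \in J (path_vertex m s i)]| <= r * m`!)%N.
Proof.
move=> Jr Qi.
have -> : (#|Q| * #|[set s : 'S_m | s i0 \in J (path_vertex m s i)]| =
    \sum_(b in Q) \sum_(s : 'S_m) (s b \in J (path_vertex m s i)))%N.
  rewrite -sum_nat_const; apply: eq_bigr => b bQ.
  rewrite (reindex_inj (mulgI (tperm i0 b))) /= -sum1_card big_mkcond /=.
  apply: eq_bigr => s _; rewrite inE (path_vertex_tperm _ _ _ _ _ (Qi _ bQ)).
  by rewrite permM tpermR; case: (_ \in _).
rewrite exchange_big /= -card_Sn mulnC -sum_nat_const; apply: leq_sum => s _.
apply: leq_trans (Jr (path_vertex m s i)).
(* For a fixed path, distinct [b] give distinct directions [s b], so at most [r] of them lie in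
   [J]. *)
rewrite -(card_preimset _ (@perm_inj _ s)) -sum1_card [X in (_ <= X)%N]big_mkcond /=.
rewrite big_mkcond /=; apply: leq_sum => b _.
by rewrite inE; case: (b \in Q); case: (_ \in _).
Qed.

(** * Ultrametrics on the cube and their light edges *)

Lemma degenerate_orientation (n r : nat) (light : {ffun 'I_n -> bool} -> 'I_n -> bool) :
  (forall x j, light (flip n x j) j = light x j) ->
  (forall U : {set {ffun 'I_n -> bool}}, U != finset.set0 ->
     exists2 x, x \in U & #|[set j | light x j && (flip n x j \in U)]| <= r)%N ->
  exists J : {ffun 'I_n -> bool} -> {set 'I_n},
    (forall x, #|J x| <= r)%N /\
    (forall x j, light x j -> (j \in J x) || (j \in J (flip n x j))).
Proof.
move=> lsym deg.
suff H (U : {set {ffun 'I_n -> bool}}) : exists J : {ffun 'I_n -> bool} -> {set 'I_n},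
    (forall x, #|J x| <= r)%N /\
    (forall x j, x \in U -> flip n x j \in U -> light x j ->
       (j \in J x) || (j \in J (flip n x j))).
  have [J [J1 J2]] := H [set: _]%SET; exists J; split=> // x j.
  by apply: J2; rewrite inE.
have [p] := ubnP #|U|; elim: p U => // p IH U; rewrite ltnS => Up.
have [->|/deg[x xU dx]] := eqVneq U finset.set0.
  by exists (fun=> finset.set0); split=> [x|x j]; rewrite ?cards0 ?inE.
have [|J [J1 J2]] := IH (U :\ x)%SET.
  by move: Up; rewrite (cardsD1 x) xU.
(* The low-degree vertex [x] is peeled off and charged for all its light edges to the rest of [U];
   induction handles the edges that avoid [x]. *)
exists (fun y => if y == x then [set j | light x j && (flip n x j \in U)]%SET else J y).
split=> [y|y j yU fU l]; first by case: ifP.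
have [E|yx] := eqVneq y x; first by rewrite -E inE l fU.
have [E|fx] := eqVneq (flip n y j) x; last by apply: J2; rewrite ?inE ?yx ?fx.
by rewrite inE -E lsym l flipK yU orbT.
Qed.

Section CubeUltrametric.
Context (R : realType) (m : nat) (D : {ffun 'I_m -> bool} -> {ffun 'I_m -> bool} -> R).
Hypothesis Dsym : forall x y, D x y = D y x.
Hypothesis Dultra : forall x y z, D x z <= Num.max (D x y) (D y z).

(** Unfolding the ultrametric inequality along the path leaves a maximum over its edges. *)
Lemma ultra_path (s : 'S_m) : (0 < m)%N ->
  exists i : 'I_m, D [ffun=> false] [ffun=> true] <=
     D (path_vertex m s i) (path_vertex m s i.+1).
Proof.
move=> m0; suff H p : (0 < p <= m)%N -> exists i : 'I_m,
    D (path_vertex m s 0) (path_vertex m s p) <= D (path_vertex m s i) (path_vertex m s i.+1).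
  by rewrite -(path_vertex0 m s) -(path_vertexT m s); apply: H; rewrite m0 leqnn.
elim: p => // p IH /= pm.
have [p0|p0] := posnP p; first by exists (Ordinal pm); rewrite /= p0.
have := Dultra (path_vertex m s 0) (path_vertex m s p) (path_vertex m s p.+1).
rewrite le_max => /orP[h|h]; last by exists (Ordinal pm).
have [|i hi] := IH; first by rewrite p0 ltnW.
by exists i; apply: le_trans h hi.
Qed.

Context (rho : R).
Hypothesis Dham : forall x y, rho * (hamming m x y)%:R <= D x y.

(* If all degrees in [U] were at least [r], a walk along light edges inside [U]
   could move away from its origin [r] times, since at Hamming distance [t] only
   [t] directions lead back; its endpoints would be too close for [D]. *)
Lemma light_degenerate (r : nat) (U : {set {ffun 'I_m -> bool}}) : (0 < r)%N ->
  U != finset.set0 -> exists2 x, x \in U &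
  (#|[set j | (D x (flip m x j) < rho * r%:R)%R && (flip m x j \in U)]| <= r)%N.
Proof.
move=> r0 /set0Pn[x0 x0U].
have [/existsP[x /andP[xU h]]|/existsPn H] := boolP [exists x, (x \in U) &&
    (#|[set j | (D x (flip m x j) < rho * r%:R)%R && (flip m x j \in U)]| <= r)%N].
  by exists x.
have deg x : x \in U ->
    (r < #|[set j | (D x (flip m x j) < rho * r%:R)%R && (flip m x j \in U)]|)%N.
  by move=> xU; have := H x; rewrite xU /= -ltnNge.
have walk t : (t <= r)%N -> exists y, [/\ y \in U, hamming m x0 y = t & D x0 y < rho * r%:R].
  elim: t => [_|t IH tr].
    (* Even [t = 0] needs [D x0 x0 < rho * r]: a light edge walked there and back gives it. *)
    have /card_gt0P[j] : (0 < #|[set j | (D x0 (flip m x0 j) < rho * r%:R)%R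
        && (flip m x0 j \in U)]|)%N by apply: leq_ltn_trans (deg _ x0U).
    rewrite inE => /andP[h _]; exists x0; split=> //.
      by apply/eqP; rewrite cards_eq0; apply/eqP/setP => i; rewrite !inE eqxx.
    by apply: le_lt_trans (Dultra _ (flip m x0 j) _) _; rewrite gt_max h Dsym h.
  have [y [yU yt Dy]] := IH (ltnW tr).
  have : ~~ ([set j | (D y (flip m y j) < rho * r%:R)%R && (flip m y j \in U)]
             \subset [set j | x0 j != y j])%SET.
    apply/negP => /subset_leq_card; apply/negP; rewrite -ltnNge.
    apply: leq_trans (ltnW (deg _ yU)).
    by move: yt; rewrite /hamming => ->.
  case/subsetPn => j; rewrite !inE negbK => /andP[h fU] /eqP xy.
  exists (flip m y j); split; [by []|by rewrite hamming_flip ?yt|].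
  by apply: le_lt_trans (Dultra _ y _) _; rewrite gt_max Dy h.
have [y [_ yr]] := walk r (leqnn r).
by have := Dham x0 y; rewrite yr ltNge => ->.
Qed.

End CubeUltrametric.

(* In the layers [4 r <= i < 12 r] a path has at least [4 r] equally likely next
   steps and [4 r] equally likely last steps, so charging the light edges to
   their endpoints makes at most half of the steps light. *)
Lemma heavy_count (R : realType) (r : nat)
    (D : {ffun 'I_(16 * r) -> bool} -> {ffun 'I_(16 * r) -> bool} -> R) (rho : R) :
  (0 < r)%N ->
  (forall x y, D x y = D y x) ->
  (forall x y z, D x z <= Num.max (D x y) (D y z)) ->
  (forall x y, rho * (hamming (16 * r) x y)%:R <= D x y) ->
  (4 * r * (16 * r)`! <= \sum_(s : 'S_(16 * r)) \sum_(i < 16 * r)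
     (rho * r%:R <= D (path_vertex (16 * r) s i) (path_vertex (16 * r) s i.+1))%R)%N.
Proof.
set m := (16 * r)%N => r0 Dsym Dultra Dham.
pose light x j := D x (flip m x j) < rho * r%:R.
have lsym x j : light (flip m x j) j = light x j by rewrite /light flipK Dsym.
have [J [Jr Jl]] := degenerate_orientation m r light lsym
  (fun U => light_degenerate R m D Dsym Dultra rho Dham r U r0).
pose mid := [set i : 'I_m | (4 * r <= i < 12 * r)%N]%SET.
have card_range (p q : nat) : (p <= q <= m)%N -> #|[set i : 'I_m | (p <= i < q)%N]%SET| = (q - p)%N.
  move=> /andP[pq qm]; rewrite -sum1_card (eq_bigl (fun i : 'I_m => (p <= i < q)%N)); last first.
    by move=> i; rewrite inE.
  rewrite -(big_mkord (fun i => (p <= i < q)%N) (fun=> 1%N)).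
  rewrite (big_cat_nat (n := p)) //=; last exact: leq_trans pq qm.
  rewrite big_nat_cond big_pred0 ?add0n; last by move=> i; lia.
  rewrite (big_cat_nat (n := q)) //= [X in (_ + X)%N]big_nat_cond [X in (_ + X)%N]big_pred0 ?addn0.
    rewrite big_nat_cond (eq_bigl (fun i => (p <= i < q)%N && true)); last by move=> i; lia.
    by rewrite -big_nat_cond sum_nat_const_nat muln1.
  by move=> i; lia.
rewrite exchange_big /=.
apply: (@leq_trans (\sum_(i in mid) \sum_(s : 'S_m)
   (rho * r%:R <= D (path_vertex m s i) (path_vertex m s i.+1))%R)%N); last first.
  by rewrite [X in (X <= _)%N]big_mkcond /=; apply: leq_sum => i _; case: ifP.
(* In each of the [8 r] middle layers half of the steps are heavy, which makes [4 r] per path on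
   average. *)
suff H i : i \in mid -> (m`! <= 2 * \sum_(s : 'S_m)
    (rho * r%:R <= D (path_vertex m s i) (path_vertex m s i.+1))%R)%N.
  have : (\sum_(i in mid) m`! <= \sum_(i in mid) 2 * \sum_(s : 'S_m)
    (rho * r%:R <= D (path_vertex m s i) (path_vertex m s i.+1))%R)%N.
    by apply: leq_sum.
  rewrite sum_nat_const -big_distrr /= card_range; last by rewrite /m; lia.
  by nia.
rewrite inE => /andP[i1 i2]; have im := ltn_ord i; have em : m = (16 * r)%N by [].
(* A light step is charged to its lower endpoint ([c1]: [m - i] directions remain) or to its upper
   one ([c2]: [i + 1] directions have been used). Both numbers are at least [4 r], so each case
   covers at most a quarter of the paths. *)
have c1 : (_ <= _)%N := path_step_count m r i i [set b : 'I_m | (i <= b < m)%N]%SET J Jr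
  ltac:(by move=> b; rewrite inE => /andP[h _]; rewrite ltnn ltnNge h).
have c2 : (_ <= _)%N := path_step_count m r i.+1 i [set b : 'I_m | (0 <= b < i.+1)%N]%SET J Jr
  ltac:(by move=> b; rewrite inE => /andP[_ h]; rewrite ltnSn h).
rewrite !card_range in c1 c2; [|lia..].
set a1 := #|_| in c1; set a2 := #|_| in c2.
have tot : (m`! <= a1 + a2 + \sum_(s : 'S_m)
    (rho * r%:R <= D (path_vertex m s i) (path_vertex m s i.+1))%R)%N.
  rewrite -card_Sn -sum1_card /a1 /a2 -!sum1_card ![\sum_(x in [set _ | _]%SET) _]big_mkcond /=.
  rewrite -!big_split /=; apply: leq_sum => s _; rewrite !inE.
  case: (leP (rho * r%:R)) => [_|h]; first by rewrite addn1.
  rewrite path_vertexS in h *; have := Jl _ _ h.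
  by case: (_ \in _); case: (_ \in _).
have {}c1 : (4 * r * a1 <= r * m`!)%N.
  by apply: leq_trans c1; rewrite leq_mul2r; apply/orP; right; lia.
have {}c2 : (4 * r * a2 <= r * m`!)%N.
  by apply: leq_trans c2; rewrite leq_mul2r; apply/orP; right; lia.
have e1 : (4 * a1 <= m`!)%N by move: c1; rewrite (mulnC 4) -mulnA leq_pmul2l.
have e2 : (4 * a2 <= m`!)%N by move: c2; rewrite (mulnC 4) -mulnA leq_pmul2l.
lia.
Qed.

(* Each path has an edge at least as long as [D(0,1)]; its other heavy edges come
   on top of that. *)
Lemma cube_gain (R : realType) (r : nat)
    (D : {ffun 'I_(16 * r) -> bool} -> {ffun 'I_(16 * r) -> bool} -> R) (rho : R) :
  (0 < r)%N -> 0 <= rho ->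
  (forall x y, D x y = D y x) ->
  (forall x y z, D x z <= Num.max (D x y) (D y z)) ->
  (forall x y, rho * (hamming (16 * r) x y)%:R <= D x y) ->
  ((16 * r)`!)%:R * (D [ffun=> false] [ffun=> true] + rho * r%:R ^+ 2) <=
  \sum_(s : 'S_(16 * r)) \sum_(i < 16 * r)
     D (path_vertex (16 * r) s i) (path_vertex (16 * r) s i.+1).
Proof.
move=> r0 rho0 Dsym Dultra Dham.
have := heavy_count R r D rho r0 Dsym Dultra Dham.
set m := (16 * r)%N; set F := m`!.
set h := fun (s : 'S_m) => (\sum_(i < m)
     (rho * r%:R <= D (path_vertex m s i) (path_vertex m s i.+1))%R)%N.
rewrite -/(\sum_s h s)%N => hcount.
have D0 x y : 0 <= D x y by apply: le_trans (Dham x y); rewrite mulr_ge0 ?ler0n.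
(* The longest edge [i] may itself be heavy, hence [h s - 1]. *)
have step s : D [ffun=> false] [ffun=> true] + rho * r%:R * ((h s)%:R - 1) <=
    \sum_(i < m) D (path_vertex m s i) (path_vertex m s i.+1).
  have [|i hi] := ultra_path R m D Dultra s; first by rewrite /m; lia.
  rewrite (bigD1 i) //= lerD //.
  rewrite /h (bigD1 i) //= natrD.
  apply: (@le_trans _ _ (rho * r%:R * (\sum_(j < m | j != i)
     (rho * r%:R <= D (path_vertex m s j) (path_vertex m s j.+1))%R)%:R)).
    by rewrite ler_wpM2l ?mulr_ge0 ?ler0n // lerBlDl lerD2r lern1 leq_b1.
  rewrite natr_sum mulr_sumr; apply: ler_sum => j _.
  by case: (leP (rho * r%:R)) => hj /=; rewrite ?mulr1 ?mulr0 ?D0.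
apply: le_trans (ler_sum _ (fun s _ => step s)).
rewrite big_split /= sumr_const card_Sn -mulr_sumr sumrB sumr_const card_Sn -natr_sum.
rewrite mulrDr mulr_natl lerD2l.
have -> : F%:R * (rho * r%:R ^+ 2) = rho * r%:R * (r * F)%:R by rewrite natrM; ring.
rewrite ler_wpM2l ?mulr_ge0 ?ler0n // lerBrDr -natrD ler_nat.
(* [4 r - 1 >= r] makes up for the edge left out. *)
apply: leq_trans hcount; rewrite -/F; nia.
Qed.

(** * Revealing scaled copies of the cube *)

Lemma cube_embedding (N m p : nat) (A B : {ffun 'I_N -> bool}) :
  hamming N A B = (m * p)%N ->
  exists phi : {ffun 'I_m -> bool} -> {ffun 'I_N -> bool},
    [/\ phi [ffun=> false] = A, phi [ffun=> true] = B &
        forall x y, hamming N (phi x) (phi y) = (p * hamming m x y)%N].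
Proof.
rewrite /hamming; set S := [set i | A i != B i]%SET => cardS.
have e : #|{: 'I_m * 'I_p}| = #|S| by rewrite cardS card_prod !card_ord.
(* [h] cuts [S] into [m] blocks of [p] coordinates; a flip of coordinate [j] in the small cube flips
   the whole block [j]. *)
pose h (z : 'I_m * 'I_p) := enum_val (cast_ord e (enum_rank z)).
have h_inj : injective h.
  by move=> z z' /enum_val_inj/cast_ord_inj/enum_rank_inj.
have hS z : h z \in S by exact: enum_valP.
have h_surj t : t \in S -> exists z, t = h z.
  move=> tS; exists (enum_val (cast_ord (esym e) (enum_rank_in tS t))).
  by rewrite /h enum_valK cast_ordKV enum_rankK_in.
pose phi (x : {ffun 'I_m -> bool}) : {ffun 'I_N -> bool} :=
  [ffun t => A t (+) [exists z, (h z == t) && x z.1]].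
have phi_in x z : phi x (h z) = A (h z) (+) x z.1.
  rewrite ffunE; congr (_ (+) _); apply/existsP/idP => [[z' /andP[/eqP/h_inj -> //]]|xz].
  by exists z; rewrite eqxx.
have phi_out x t : t \notin S -> phi x t = A t.
  move=> tS; rewrite ffunE; suff -> : [exists z, (h z == t) && x z.1] = false by rewrite addbF.
  by apply/existsP => -[z /andP[/eqP ht _]]; rewrite -ht hS in tS.
exists phi; split.
- apply/ffunP => t; have [/h_surj[z ->]|/phi_out//] := boolP (t \in S).
  by rewrite phi_in ffunE addbF.
- apply/ffunP => t; have [tS|tS] := boolP (t \in S); last first.
    by rewrite phi_out //; move: tS; rewrite inE negbK => /eqP.
  have [z tz] := h_surj t tS; rewrite tz phi_in ffunE -tz addbT.
  by move: tS; rewrite inE; case: (A t); case: (B t).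
move=> x y.
have -> : [set i | phi x i != phi y i]%SET =
    (h @: finset.setX [set j | x j != y j] [set: 'I_p])%SET.
  apply/setP => t; rewrite inE; apply/idP/imsetP => [|[z + ->]]; last first.
    by rewrite !inE andbT !phi_in; case: (A _); case: (x _); case: (y _).
  have [/h_surj[z ->]|tS] := boolP (t \in S); last by rewrite !phi_out // eqxx.
  move=> hz; exists z => //; rewrite !inE andbT; move: hz; rewrite !phi_in.
  by apply: contra => /eqP ->.
by rewrite card_imset // cardsX cardsT card_ord mulnC.
Qed.

Lemma extend_tuple (V : finType) (k : nat) (p : seq V) :
  uniq p -> (size p <= k <= #|V|)%N ->
  exists s : k.-tuple V, uniq s /\ take (size p) s = p.
Proof.
move=> up /andP[pk kV]; pose q := p ++ [seq x <- enum V | x \notin p].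
have uq : uniq q.
  rewrite cat_uniq up filter_uniq ?enum_uniq // andbT /=.
  by apply/hasPn => x; rewrite mem_filter => /andP[].
have sq : size q = #|V|.
  rewrite cardE; apply/perm_size/uniq_perm; rewrite ?enum_uniq // => x.
  by rewrite mem_cat mem_filter mem_enum andbT orbN.
have sk : size (take k q) == k by rewrite size_takel ?sq.
exists (Tuple sk); split; first exact: take_uniq.
by rewrite /= take_takel // take_size_cat.
Qed.

(** Terminals must be distinct, so only the points of [phi] not among the first [n] are appended;
    [pos] looks each point up in the resulting list. *)
Lemma reveal (V H : finType) (k n : nat) (s : k.-tuple V) (phi : H -> V) :
  uniq s -> (n + #|H| <= k <= #|V|)%N ->
  exists (s' : k.-tuple V) (pos : H -> 'I_k),
    [/\ uniq s', take n s' = take n s &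
        forall x, tnth s' (pos x) = phi x /\ (pos x < n + #|H|)%N].
Proof.
move=> us /andP[nk kV].
pose p := take n s ++ [seq x <- undup (codom phi) | x \notin take n s].
have up : uniq p.
  rewrite cat_uniq take_uniq // filter_uniq ?undup_uniq // andbT /=.
  by apply/hasPn => x; rewrite mem_filter => /andP[].
have sn : size (take n s) = n.
  by rewrite size_takel // size_tuple (leq_trans _ nk) // leq_addr.
have sp : (size p <= n + #|H|)%N.
  rewrite size_cat sn leq_add2l size_filter (leq_trans (count_size _ _)) //.
  by rewrite (leq_trans (size_undup _)) // size_codom.
have [|s' [us' ps']] := extend_tuple V k p up; first by rewrite (leq_trans sp).
have mem_p x : phi x \in p.
  by rewrite mem_cat mem_filter mem_undup codom_f andbT orbN.
have idx x : (index (phi x) p < k)%N.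
  by rewrite (leq_trans _ nk) // (leq_trans _ sp) // index_mem.
exists s', (fun x => Ordinal (idx x)); split=> // [|x].
  have np : (n <= size p)%N by rewrite size_cat sn leq_addr.
  by rewrite -(take_takel _ np) ps' take_cat sn ltnn subnn take0 cats0.
split; last by rewrite /= (leq_trans _ sp) // index_mem.
rewrite (tnth_nth (phi x)) /= -(nth_take _ (n0 := size p)) ?index_mem //.
by rewrite ps' nth_index.
Qed.

(** * Averaging over edges, and one round of the adversary *)

Lemma exists_integral_ge (R : realType) (dsp : measure_display)
    (Omega : measurableType dsp) (P : probability Omega R) (I : finType)
    (f : I -> Omega -> R) (g : Omega -> R) (K m v c : R) :
  0 < K -> 0 < m -> 0 <= c -> (#|I|%:R = K * m) ->
  (forall i w, 0 <= f i w) -> (forall w, 0 <= g w) ->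
  (forall i, measurable_fun setT (f i)) -> measurable_fun setT g ->
  (v%:E <= \int[P]_w (g w)%:E)%E ->
  (forall w, K * (g w + c) <= \sum_i f i w) ->
  exists i, (((v + c) / m)%:E <= \int[P]_w (f i w)%:E)%E.
Proof.
move=> K0 m0 c0 cardI f0 g0 mf mg vg Kg.
have int_g : (\int[P]_w (K * (g w + c))%:E = K%:E * (\int[P]_w (g w)%:E + c%:E))%E.
  under eq_integral do rewrite EFinM.
  rewrite ge0_integralZl_EFin //; last 3 first.
  - by move=> w _; rewrite lee_fin addr_ge0.
  - by apply/measurable_EFinP; apply: measurable_funD.
  - exact: ltW.
  congr (_ * _)%E; under eq_integral do rewrite EFinD.
  rewrite ge0_integralD //.
  - congr (_ + _)%E; rewrite -[RHS]mule1 -(probability_setT P).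
    exact: (integral_cst P measurableT c%:E).
  - by move=> w _; rewrite lee_fin.
  - exact/measurable_EFinP.
have int_f : (\int[P]_w (\sum_i f i w)%:E = \sum_i \int[P]_w (f i w)%:E)%E.
  under eq_integral do rewrite -sumEFin.
  rewrite ge0_integral_sum // => [i|i w _]; last by rewrite lee_fin.
  exact/measurable_EFinP.
have le_sum : ((K * (v + c))%:E <= \sum_i \int[P]_w (f i w)%:E)%E.
  rewrite -int_f; apply: (@le_trans _ _ (\int[P]_w (K * (g w + c))%:E)%E).
    by rewrite int_g EFinM lee_pmul2l // ?lte_fin // EFinD leeD2r.
  apply: ge0_le_integral => //.
  - by move=> w _; rewrite lee_fin mulr_ge0 ?addr_ge0 // ltW.
  - by apply/measurable_EFinP; apply: measurable_funM => //; apply: measurable_funD.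
  - by apply/measurable_EFinP; apply: measurable_sum.
  - by move=> w _; rewrite lee_fin.
(* If all expectations were below [(v + c) / m], their sum over [K * m] indices would be below
   [K * (v + c)]. *)
have [/existsP[i hi]|/existsPn none] :=
    boolP [exists i, (((v + c) / m)%:E <= \int[P]_w (f i w)%:E)%E].
  by exists i.
(* Being below a real number, the expectations are finite, so the comparison can take place in
   [R]. *)
have fin i : ((fine (\int[P]_w (f i w)%:E))%:E = \int[P]_w (f i w)%:E)%E.
  rewrite fineK // ge0_fin_numE; last by apply: integral_ge0 => w _; rewrite lee_fin.
  by have := none i; rewrite -ltNge => /lt_le_trans; apply; rewrite leey.
exfalso; move: le_sum; apply/negP; rewrite -ltNge.
under eq_bigr do rewrite -fin.
rewrite sumEFin lte_fin.
apply: (@lt_le_trans _ _ (\sum_(i : I) (v + c) / m)); last first.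
  by rewrite sumr_const -mulr_natl cardI -mulrA (mulrC m) divfK // gt_eqF.
have I0 : (0 < #|I|)%N by rewrite -(ltr_nat R) cardI mulr_gt0.
apply: ltr_sum => [|i _]; last by rewrite -lte_fin fin ltNge none.
by case/card_gt0P: I0 => i _; apply/hasP; exists i; rewrite // mem_index_enum.
Qed.

Lemma adversary_step (R : realType) (N k r rho n : nat) (dsp : measure_display)
    (Omega : measurableType dsp) (P : probability Omega R)
    (A : Omega -> online_alg R {ffun 'I_N -> bool} k) (s : k.-tuple {ffun 'I_N -> bool})
    (a b : 'I_k) (v : R) :
  (forall w, valid_online_alg (fun x y => (hamming N x y)%:R) (A w)) ->
  (forall (s : k.-tuple {ffun 'I_N -> bool}) (a b : 'I_k), uniq s ->
     measurable_fun setT (fun w => pair_dist (A w) s a b)) ->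
  (0 < r)%N -> (n + 2 ^ (16 * r) <= k <= 2 ^ N)%N ->
  uniq s -> (a < n)%N -> (b < n)%N ->
  hamming N (tnth s a) (tnth s b) = (16 * r * rho)%N ->
  (v%:E <= \int[P]_w (pair_dist (A w) s a b)%:E)%E ->
  exists (s' : k.-tuple {ffun 'I_N -> bool}) (a' b' : 'I_k),
    [/\ uniq s', (a' < n + 2 ^ (16 * r))%N, (b' < n + 2 ^ (16 * r))%N,
        hamming N (tnth s' a') (tnth s' b') = rho &
        (((v + rho%:R * r%:R ^+ 2) / (16 * r)%:R)%:E <=
          \int[P]_w (pair_dist (A w) s' a' b')%:E)%E].
Proof.
move=> valid meas r0 nk us an bn hab hv.
set m := (16 * r)%N in nk hab *.
have m0 : (0 < m)%N by rewrite muln_gt0 r0.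
have [phi [phi0 phi1 phiH]] := cube_embedding N m rho _ _ hab.
have cardV (p : nat) : #|{ffun 'I_p -> bool}| = (2 ^ p)%N.
  by rewrite card_ffun card_bool card_ord.
have [|s' [pos [us' ss' hpos]]] := reveal _ _ k n s phi us.
  by rewrite !cardV.
rewrite cardV in hpos.
(* The two antipodes were revealed before, so they sit at the old positions [a] and [b]. *)
have prefix (c : 'I_k) x : (c < n)%N -> phi x = tnth s c -> pos x = c.
  move=> cn pc; apply/ord_inj/eqP; have [px _] := hpos x.
  rewrite -(nth_uniq (phi x) _ _ us') ?size_tuple // -tnth_nth px.
  by rewrite -(nth_take _ cn) ss' nth_take // -tnth_nth pc.
have pos0 : pos [ffun=> false] = a by apply: prefix.
have pos1 : pos [ffun=> true] = b by apply: prefix.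
pose D w x y := pair_dist (A w) s' (pos x) (pos y).
have hst w := (valid w).1 s' us'.
have Dsym w x y : D w x y = D w y x by exact: hst_dist_sym.
have Dultra w x y z : D w x z <= Num.max (D w x y) (D w y z).
  by apply: hst_dist_ultra; case: (hst w).
have Dham w x y : rho%:R * (hamming m x y)%:R <= D w x y.
  have [_ [_ /(_ (pos x) (pos y))]] := hst w.
  by rewrite !(hpos _).1 phiH natrM.
have D0 w x y : 0 <= D w x y by apply: le_trans (Dham w x y); rewrite mulr_ge0.
(* The average runs over the [m!] paths with [m] steps each; [c] is the gain from heavy edges. *)
have [|||||||||w|[sigma i] hi] := exists_integral_ge R dsp Omega P ('S_m * 'I_m)%type
   (fun c w => D w (path_vertex m c.1 c.2) (path_vertex m c.1 c.2.+1))
   (fun w => D w [ffun=> false] [ffun=> true]) (m`!)%:R m%:R v (rho%:R * r%:R ^+ 2).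
- by rewrite ltr0n fact_gt0.
- by rewrite ltr0n.
- by rewrite mulr_ge0 // exprn_ge0.
- by rewrite card_prod card_Sn card_ord natrM.
- by move=> c w; exact: D0.
- by move=> w; exact: D0.
- by move=> c; exact: meas.
- exact: meas.
(* [s] and [s'] agree on the first [n] terminals, so an online algorithm gives [a] and [b] the same
   distance on both. *)
- apply: le_trans hv _; rewrite /D pos0 pos1 le_eqVlt; apply/orP; left; apply/eqP.
  apply: eq_integral => w _; congr (_%:E).
  by have := (valid w).2 s s' n us us' (esym ss') a b an bn.
- apply: le_trans (cube_gain R r (D w) rho%:R r0 _ _ _ _) _ => //.
  by rewrite pair_big.
exists s', (pos (path_vertex m sigma i)), (pos (path_vertex m sigma i.+1)).
split=> //; [by have [] := hpos (path_vertex m sigma i)|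
  by have [] := hpos (path_vertex m sigma i.+1)|].
rewrite !(hpos _).1 phiH path_vertexS hamming_flip //.
rewrite /hamming (_ : [set j | _]%SET = finset.set0) ?cards0 ?muln1 //.
by apply/setP => j; rewrite !inE eqxx.
Qed.

(** * The Hamming metric and its aspect ratio *)

Lemma hamming0P (n : nat) (x y : {ffun 'I_n -> bool}) : hamming n x y = 0%N <-> x = y.
Proof.
split=> [/eqP|->].
  rewrite cards_eq0 => /eqP/setP h; apply/ffunP => i.
  by have := h i; rewrite !inE => /negbFE/eqP.
by apply/eqP; rewrite cards_eq0; apply/eqP/setP => i; rewrite !inE eqxx.
Qed.

Lemma hamming_compl (n : nat) : hamming n [ffun=> false] [ffun=> true] = n.
Proof.
rewrite /hamming (_ : [set i | _]%SET = [set: 'I_n]%SET) ?cardsT ?card_ord //.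
by apply/setP => i; rewrite !inE !ffunE.
Qed.

Lemma hamming_metric (R : realType) (n : nat) :
  is_metric (fun x y : {ffun 'I_n -> bool} => (hamming n x y)%:R : R).
Proof.
split=> [x y|]; first exact: ler0n.
split=> [x y|].
  split=> [/eqP|/hamming0P ->//]; rewrite pnatr_eq0 => /eqP; exact: (hamming0P n x y).1.
split=> [x y|x y z].
  by congr (_%:R); apply: eq_card => i; rewrite !inE eq_sym.
rewrite -natrD ler_nat; apply: leq_trans (leq_card_setU _ _).
apply/subset_leq_card/fintype.subsetP => i; rewrite !inE.
by case: (x i); case: (y i); case: (z i).
Qed.

Lemma hamming_aspect_ratio (R : realType) (n : nat) : (0 < n)%N ->
  aspect_ratio (fun x y : {ffun 'I_n -> bool} => (hamming n x y)%:R : R) = n%:R.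
Proof.
move=> n0; rewrite /aspect_ratio.
have max_n : max_dist (fun x y : {ffun 'I_n -> bool} => (hamming n x y)%:R : R) = n%:R.
  apply/eqP; rewrite eq_le; apply/andP; split.
    apply/bigmax_leP; split=> // x _; apply/bigmax_leP; split=> // y _.
    by rewrite ler_nat /hamming (leq_trans (max_card _)) // card_ord.
  apply: (bigmax_sup [ffun=> false]) => //; apply: (bigmax_sup [ffun=> true]) => //.
  by rewrite hamming_compl.
have min_1 : min_dist (fun x y : {ffun 'I_n -> bool} => (hamming n x y)%:R : R) = 1.
  rewrite /min_dist max_n; apply/eqP; rewrite eq_le; apply/andP; split.
    pose x : {ffun 'I_n -> bool} := [ffun=> false].
    have xx : hamming n x (flip n x (Ordinal n0)) = 1%N.
      by rewrite hamming_flip // (hamming0P n x x).2.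
    apply: (bigmin_inf x) => //; apply: (bigmin_inf (flip n x (Ordinal n0))); last by rewrite xx.
    by apply/eqP => E; move: xx; rewrite E (hamming0P n x x).2.
  apply/bigmin_geP; split=> [|x _]; first by rewrite ler1n.
  apply/bigmin_geP; split=> [|y yx]; first by rewrite ler1n.
  rewrite ler1n lt0n; apply/negP => /eqP/hamming0P E.
  by rewrite E eqxx in yx.
by rewrite max_n min_1 divr1.
Qed.

(** * All rounds, and the resulting distortion *)

Lemma adversary_rounds (R : realType) (r L k : nat) (dsp : measure_display)
    (Omega : measurableType dsp) (P : probability Omega R)
    (A : Omega -> online_alg R {ffun 'I_((16 * r) ^ L) -> bool} k) :
  (forall w, valid_online_alg (fun x y => (hamming ((16 * r) ^ L) x y)%:R) (A w)) ->
  (forall (s : k.-tuple {ffun 'I_((16 * r) ^ L) -> bool}) (a b : 'I_k), uniq s ->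
     measurable_fun setT (fun w => pair_dist (A w) s a b)) ->
  (0 < r)%N -> (2 + L * 2 ^ (16 * r) <= k <= 2 ^ ((16 * r) ^ L))%N ->
  forall i, (i <= L)%N ->
  exists (s : k.-tuple {ffun 'I_((16 * r) ^ L) -> bool}) (a b : 'I_k),
    [/\ uniq s, (a < 2 + i * 2 ^ (16 * r))%N, (b < 2 + i * 2 ^ (16 * r))%N,
        hamming ((16 * r) ^ L) (tnth s a) (tnth s b) = ((16 * r) ^ (L - i))%N &
        ((i%:R * (r%:R / 16) * ((16 * r) ^ (L - i))%:R)%:E <=
          \int[P]_w (pair_dist (A w) s a b)%:E)%E].
Proof.
move=> valid meas r0 /andP[kL kV].
have N0 : (0 < (16 * r) ^ L)%N by rewrite expn_gt0 muln_gt0 r0.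
set N := ((16 * r) ^ L)%N in A valid meas kV N0 *.
have cardV : #|{ffun 'I_N -> bool}| = (2 ^ N)%N by rewrite card_ffun card_bool card_ord.
have k2 : (2 <= k)%N by apply: leq_trans kL; rewrite leq_addr.
elim=> [_|i IH iL].
  pose p : seq {ffun 'I_N -> bool} := [:: [ffun=> false]; [ffun=> true]].
  have up : uniq p.
    rewrite /= inE andbT; apply/negP => /eqP/ffunP/(_ (Ordinal N0)).
    by rewrite !ffunE.
  have [|s [us ps]] := extend_tuple _ k p up; first by rewrite cardV k2 kV.
  have k1 : (1 < k)%N by [].
  exists s, (Ordinal (ltnW k1)), (Ordinal k1); split=> //.
    have nth_s j : (j < 2)%N -> nth [ffun=> false] s j = nth [ffun=> false] p j.
      by move=> j2; rewrite -(nth_take _ j2) ps.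
    by rewrite !(tnth_nth [ffun=> false]) /= !nth_s // subn0 hamming_compl.
  rewrite mul0r mul0r; apply: integral_ge0 => w _; rewrite lee_fin.
  have [_ [_ /(_ (Ordinal (ltnW k1)) (Ordinal k1))]] := (valid w).1 s us.
  by apply: le_trans.
have [s [a [b [us ai bi hab vi]]]] := IH (ltnW iL).
have nk : (2 + i * 2 ^ (16 * r) + 2 ^ (16 * r) <= k <= 2 ^ N)%N.
  rewrite kV andbT -addnA -mulSnr (leq_trans _ kL) // leq_add2l leq_mul2r iL orbT //.
have ex : ((16 * r) ^ (L - i) = 16 * r * (16 * r) ^ (L - i.+1))%N.
  by rewrite -expnS; congr (_ ^ _)%N; lia.
rewrite ex in hab.
have [s' [a' [b' [us' ai' bi' hab' vi']]]] :=
  adversary_step R N k r _ _ dsp Omega P A s a b _ valid meas r0 nk us ai bi hab vi.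
exists s', a', b'; split=> //.
- by rewrite mulSnr addnA.
- by rewrite mulSnr addnA.
(* With [rho] the new distance, division by [16 r] turns [i (r / 16) (16 r rho) + rho r^2] into
   [(i + 1) (r / 16) rho]. *)
apply: le_trans vi'; rewrite lee_fin ex !natrM -natr1.
have r0' : r%:R != 0 :> R by rewrite pnatr_eq0 -lt0n.
rewrite le_eqVlt; apply/orP; left; apply/eqP; field.
by rewrite r0'.
Qed.

Lemma expected_distortion_lower_bound (R : realType) (r L k : nat) (dsp : measure_display)
    (Omega : measurableType dsp) (P : probability Omega R)
    (A : Omega -> online_alg R {ffun 'I_((16 * r) ^ L) -> bool} k) :
  (forall w, valid_online_alg (fun x y => (hamming ((16 * r) ^ L) x y)%:R) (A w)) ->
  (forall (s : k.-tuple {ffun 'I_((16 * r) ^ L) -> bool}) (a b : 'I_k), uniq s ->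
     measurable_fun setT (fun w => pair_dist (A w) s a b)) ->
  (0 < r)%N -> (2 + L * 2 ^ (16 * r) <= k <= 2 ^ ((16 * r) ^ L))%N ->
  exists s : k.-tuple {ffun 'I_((16 * r) ^ L) -> bool}, uniq s /\
    ((L%:R * (r%:R / 16))%:E <= expected_distortion
       (fun x y => (hamming ((16 * r) ^ L) x y)%:R) P A s)%E.
Proof.
move=> valid meas r0 hk.
have [s [a [b [us _ _]]]] := adversary_rounds R r L k dsp Omega P A valid meas r0 hk L (leqnn L).
rewrite subnn expn0 mulr1 => hab vab; exists s; split=> //.
have sym (x y : {ffun 'I_((16 * r) ^ L) -> bool}) : hamming _ x y = hamming _ y x.
  by apply: eq_card => i; rewrite !inE eq_sym.
have psym w c d : pair_dist (A w) s c d = pair_dist (A w) s d c by exact: hst_dist_sym.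
(* [expected_distortion] ranges over [a < b] only; distance 1 excludes [a = b]. *)
wlog ab : a b hab vab / (a < b)%N => [W|].
  have [ab|ba|E] := ltngtP a b; first exact: (W a b).
    apply: (W b a) => //; first by rewrite sym.
    by under eq_integral do rewrite psym.
  move: hab; have -> : a = b by apply: val_inj.
  by rewrite (hamming0P _ _ _).2.
rewrite /expected_distortion.
apply: (bigmax_sup a) => //; apply: (bigmax_sup b) => //.
by rewrite hab invr1 mule1.
Qed.

(* With [a >= 2 / delta], the choice [L = 2 ^ (m * a)] gives [k <= 2 ^ (m * (a + 2))]
   and hence [k ^ (1 - delta) <= L <= log2 (m ^ L)]. *)
Section NumberOfRounds.
Context (R : realType) (delta : R) (a : nat) (m : nat).
Hypothesis delta01 : 0 < delta < 1.
Hypothesis a_delta : 2 / delta <= a%:R.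
Hypothesis m16 : (16 <= m)%N.

Let L := (2 ^ (m * a))%N.
Let k := (2 + L * 2 ^ m)%N.

Lemma two_le_a : (2 <= a)%N.
Proof.
rewrite -(ler_nat R); apply: le_trans a_delta; case/andP: delta01 => d0 d1.
by rewrite ler_pdivlMr // ler_piMr // ltW.
Qed.

Lemma terminals_bounds : (2 ^ (m * a.+1) <= k <= 2 ^ (m * a.+2))%N.
Proof.
rewrite /k /L -expnD -mulnSr leq_addl /= [(m * a.+2)%N]mulnSr.
set e := (m * a.+1)%N.
apply: (@leq_trans (2 ^ e.+1)).
  rewrite expnS mul2n -addnn leq_add2r -[X in (X <= _)%N]expn1 leq_exp2l // /e muln_gt0 /=.
  by lia.
by rewrite leq_exp2l //; lia.
Qed.

(** This provides [k] distinct points to reveal; the exponent [m (a + 2)] from the bound on [k]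
    stays below [m ^ L]. *)
Lemma terminals_le_card : (k <= 2 ^ (m ^ L))%N.
Proof.
have /andP[_ /leq_trans] := terminals_bounds; apply.
rewrite leq_exp2l //.
have L0 : (0 < L)%N by rewrite expn_gt0.
rewrite -(prednK L0) expnS leq_mul2l; apply/orP; right.
have h1 : (L.-1 < m ^ L.-1)%N by apply: ltn_expl; lia.
have h2 : (m * a < L)%N by apply: ltn_expl.
have := two_le_a; nia.
Qed.

Lemma aspect_ratio_large : 2 `^ (k%:R `^ (1 - delta)) <= (m ^ L)%:R :> R.
Proof.
case/andP: delta01 => d0 d1.
have k_le : k%:R `^ (1 - delta) <= L%:R.
  have /andP[_ kle] := terminals_bounds.
  apply: (@le_trans _ _ ((2 ^ (m * a.+2))%:R `^ (1 - delta))).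
    by apply: ge0_ler_powR; rewrite ?nnegrE ?ler0n ?ler_nat // subr_ge0 ltW.
  rewrite /L !natrX -!powR_mulrn // -powRrM; apply: ler_powR; first by rewrite ler1n.
  rewrite !natrM -mulrA ler_wpM2l //.
  (* [(a + 2) (1 - delta) <= a] follows from [a * delta >= 2]. *)
  have : 2 <= a%:R * delta by rewrite -ler_pdivrMr.
  rewrite -[a.+2%:R]natr1 -[a.+1%:R]natr1; nra.
apply: (@le_trans _ _ (2 `^ L%:R)); first by apply: ler_powR; rewrite ?ler1n.
rewrite powR_mulrn // natrX lerXn2r ?nnegrE ?ler0n // ler_nat; lia.
Qed.

(** [ln (ln k) >= ln m] cancels that factor in [ln (m ^ L) = L ln m], and [ln k <= m (a + 2)] leaves
    [L * m / 256 = L * r / 16]. *)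
Lemma distortion_bound (r : nat) : m = (16 * r)%N ->
  (256 * a.+2%:R)^-1 * ln k%:R * ln (m ^ L)%:R / ln (ln k%:R) <= L%:R * (r%:R / 16) :> R.
Proof.
move=> mr.
have m0 : 0 < m%:R :> R by rewrite ltr0n; lia.
have m1 : 1 < m%:R :> R by rewrite ltr1n; lia.
have a2 : 0 < a.+2%:R :> R by rewrite ltr0n.
have ln2_le : ln 2 <= 1 :> R by rewrite -[2]/(1 + 1); apply: le_ln1Dx; lra.
(* This is [ln (1 - 1/2) <= - 1/2]. *)
have ln2_ge : 2^-1 <= ln 2 :> R.
  have := @le_ln1Dx R (- 2^-1) ltac:(lra).
  by rewrite (_ : 1 - 2^-1 = 2^-1 :> R) ?lnV ?posrE //; lra.
have /andP[kge kle] := terminals_bounds.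
have k0 : 0 < k%:R :> R by rewrite ltr0n.
have lnk_le : ln k%:R <= (m * a.+2)%:R :> R.
  apply: (@le_trans _ _ (ln (2 ^ (m * a.+2))%:R)).
    by rewrite ler_ln ?posrE ?ltr0n ?expn_gt0 // ler_nat.
  by rewrite natrX lnXn // -[leLHS]mulr_natl ler_piMr.
have lnk_ge : m%:R <= ln k%:R :> R.
  apply: (@le_trans _ _ (ln (2 ^ (m * a.+1))%:R)); last first.
    by rewrite ler_ln ?posrE ?ltr0n ?expn_gt0 // ler_nat.
  rewrite natrX lnXn // -[leRHS]mulr_natl natrM -mulrA ler_peMr // ?ltW //.
  have : 3 <= a.+1%:R :> R by rewrite ler_nat; have := two_le_a; lia.
  nra.
have lnm0 : 0 < ln m%:R :> R by rewrite ln_gt0.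
have lnlnk : ln m%:R <= ln (ln k%:R) :> R.
  by rewrite ler_ln ?posrE // (lt_le_trans m0).
have lnlnk0 := lt_le_trans lnm0 lnlnk.
rewrite natrX lnXn // ler_pdivrMr // -[ln _ *+ _]mulr_natl.
apply: (@le_trans _ _ ((256 * a.+2%:R)^-1 * (m * a.+2)%:R * (L%:R * ln m%:R))).
  rewrite ler_wpM2r ?mulr_ge0 ?ler0n ?(ltW lnm0) // ler_wpM2l // invr_ge0 mulr_ge0 // ltW.
rewrite [leLHS]mulrA ler_pM ?mulr_ge0 ?invr_ge0 ?ler0n ?(ltW lnm0) //.
rewrite mr !natrM le_eqVlt; apply/orP; left; apply/eqP; field.
by rewrite -natr1 -natr1 in a2; rewrite gt_eqF.
Qed.

End NumberOfRounds.

(** * The family for a given [delta] *)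

Theorem theorem1p5 (R : realType) (delta : R) :
  0 < delta < 1 ->
  exists c : R, 0 < c /\
  exists (V : nat -> finType) (dV : forall l, V l -> V l -> R) (k : nat -> nat),
    (forall l, is_metric (dV l)) /\
    (forall l, (k l < k l.+1)%N) /\
    (forall l, 2 `^ ((k l)%:R `^ (1 - delta)) <= aspect_ratio (dV l)) /\
    (forall l (dsp : measure_display) (Omega : measurableType dsp)
            (P : probability Omega R) (A : Omega -> online_alg R (V l) (k l)),
       (forall w, valid_online_alg (dV l) (A w)) ->
       (forall (s : (k l).-tuple (V l)) (a b : 'I_(k l)), uniq s ->
          measurable_fun setT (fun w => pair_dist (A w) s a b)) ->
       exists s : (k l).-tuple (V l), uniq s /\
         ((c * ln (k l)%:R * ln (aspect_ratio (dV l)) / ln (ln (k l)%:R))%:E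
            <= expected_distortion (dV l) P A s)%E).
Proof.
move=> d01; case/andP: (d01) => d0 d1.
pose a := Num.Def.archi_bound (2 / delta).
have a_delta : 2 / delta <= a%:R by apply/ltW/archi_boundP; rewrite divr_ge0 // ltW.
(* The successor keeps [r] positive at [l = 0]; as [r] grows, so does the number of terminals. *)
pose r (l : nat) := l.+1.
pose L l := (2 ^ (16 * r l * a))%N.
pose N l := ((16 * r l) ^ L l)%N.
have m16 l : (16 <= 16 * r l)%N by rewrite /r; lia.
have N0 l : (0 < N l)%N by rewrite expn_gt0 muln_gt0.
(* The constant depends on [delta] alone, through [a]. *)
exists (256 * a.+2%:R)^-1; split; first by rewrite invr_gt0 mulr_gt0 // ltr0n.
exists (fun l => {ffun 'I_(N l) -> bool}), (fun l x y => (hamming (N l) x y)%:R).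
exists (fun l => 2 + L l * 2 ^ (16 * r l))%N.
split; first by move=> l; exact: hamming_metric.
split=> [l|].
  rewrite ltn_add2l -!expnD ltn_exp2l // /r.
  by nia.
split=> [l|l dsp Omega P A valid meas].
  rewrite hamming_aspect_ratio //.
  exact: (aspect_ratio_large R delta a (16 * r l) d01 a_delta (m16 l)).
have [|s [us hs]] := expected_distortion_lower_bound R (r l) (L l) _ dsp Omega P A valid meas isT.
  by rewrite leqnn (terminals_le_card R delta a _ d01 a_delta (m16 l)).
exists s; split=> //; apply: le_trans hs; rewrite lee_fin hamming_aspect_ratio //.
exact: (distortion_bound R delta a (16 * r l) d01 a_delta (m16 l) (r l) erefl).
Qed.
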